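(* Let $G$ be a compact metrisable abelian topological group (written additively), let $(\Omega,\mathcal{F},P)$ be a probability space, and let $X,Y:\Omega\to G$ be independent random variables such that $X\sim X+Y$. Then the random variables $X+Y$ and $Y$ are independent.
   Context: A random variable with values in a topological space $G$ is a map $X:\Omega\to G$ such that $X^{-1}(B)$ is measurable for every Borel set $B\subset G$. Its distribution is the Borel probability measure $\mu_X(B)=P(X\in B)$ on $G$. For $G$-valued random variables $X,Z$, $X\sim Z$ means that they have the same distribution, i.e. $\mu_X=\mu_Z$. *)

(* Defs.v *)
From HB Require Import structures.
From mathcomp Require Import all_boot all_order all_algebra finmap.
From mathcomp Require Import all_classical all_reals all_analysis.

Set Implicit Arguments.
Unset Strict Implicit.
Unset Printing Implicit Defensive.

Import Order.TTheory GRing.Theory Num.Theory.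
Import numFieldNormedType.Exports.

Local Open Scope classical_set_scope.
Local Open Scope ring_scope.

Definition metrisable (R : realType) (T : topologicalType) : Prop :=
  exists rho : T -> T -> R,
    [/\ forall x y, rho x y = 0 <-> x = y,
        forall x y, rho x y = rho y x,
        forall x y z, rho x z <= rho x y + rho y z &
        forall x, nbhs x =
          filter_from [set e : R | 0 < e] (fun e => [set y | rho x y < e])].

(* [borel G] is the group [G] together with its Borel sigma-algebra. The base
   point [0] is there only because a [measurableType] has to be pointed. *)
Definition borel (G : topologicalZmodType) : Type := G.

HB.instance Definition _ (G : topologicalZmodType) :=
  TopologicalZmodule.on (borel G).
HB.instance Definition _ (G : topologicalZmodType) :=
  isPointed.Build (borel G) 0.
HB.instance Definition _ (G : topologicalZmodType) :=
  Measurable.copy (borel G) (g_sigma_algebraType (@open (borel G))).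

(* Equality of laws is required on measurable sets only: [distribution P X]
   is a total function on sets, with unspecified values elsewhere. *)
Definition same_distribution d d' (T : measurableType d)
    (T' : measurableType d') (R : realType) (P : probability T R)
    (X Z : {RV P >-> T'}) : Prop :=
  forall B : set T', measurable B -> distribution P X B = distribution P Z B.
Arguments same_distribution {d d' T T' R} P X Z.

Definition independent d d1 d2 (T : measurableType d)
    (T1 : measurableType d1) (T2 : measurableType d2) (R : realType)
    (P : probability T R) (X : {RV P >-> T1}) (Z : {RV P >-> T2}) : Prop :=
  forall (A : set T1) (B : set T2), measurable A -> measurable B ->
    P (X @^-1` A `&` Z @^-1` B) = (P (X @^-1` A) * P (Z @^-1` B))%E.
Arguments independent {d d1 d2 T T1 T2 R} P X Z.

Lemma metrisable_second_countable (R : realType) (T : ptopologicalType) :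
  compact [set: T] -> metrisable R T -> @second_countable T.
Proof.
move=> cT [rho [rho0 rhoC rhoD rhoE]].
have rhoxx x : rho x x = 0 by apply/rho0.
have nrho x (e : R) : 0 < e -> nbhs x [set y | rho x y < e].
  by move=> e0; rewrite rhoE; exists e.
pose f n z : set T := [set y | rho z y < n.+1%:R^-1]°.
have h n : finite_subset_cover [set: T] (f n) [set: T].
  move: cT; rewrite compact_cover; apply.
  - by move=> z _; exact: open_interior.
  - by move=> z _; exists z => //; rewrite /f /interior; exact: nrho.
pose h' n := cid (iffLR (exists2P _ _) (h n)).
pose h'' n := projT1 (h' n).
pose B := \bigcup_n (f n) @` [set` h'' n].
exists B; [|split].
- apply: bigcup_countable => // n _; apply: finite_set_countable.
  exact/finite_image/finite_fset.
- by move=> ? [? _ [? _ <-]]; exact: open_interior.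
- move=> x V; rewrite {1}/nbhs/= -/(nbhs x V) rhoE => -[e /= e0 eV].
  have [|N] := @ltr_add_invr R 0 (e / 2); first by rewrite divr_gt0.
  rewrite add0r => Ne.
  have [w wh fx] : exists2 w : T, w \in h'' N & f N w x.
    by have [_ /(_ x) [// | w ? ?]] := projT2 (h' N); exists w.
  exists (f N w); first by split => //; exists N => //; exists w.
  move=> z fz; apply: eV => /=.
  rewrite (le_lt_trans (rhoD x w z))// [e]splitr ltrD//.
    by rewrite rhoC (lt_trans _ Ne)//; exact: (interior_subset fx).
  by rewrite (lt_trans _ Ne)//; exact: (interior_subset fz).
Qed.

Section add_random_variables.
Context (R : realType) (G : topologicalZmodType).
Hypotheses (cG : compact [set: G]) (mG : metrisable R G).
Context d (T : measurableType d) (P : probability T R).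
Variables X Y : {RV P >-> borel G}.

Lemma measurable_funD_borel : measurable_fun setT (X \+ Y : T -> borel G).
Proof.
apply: (measurability (@open (borel G))) => // _ [U oU <-]; rewrite setTI.
have [B cB [Bop Bb]] := @metrisable_second_countable R (borel G) cG mG.
have /pcard_surjP[g gB] := cB.
pose ok (p : nat * nat) := [/\ open (g p.1), open (g p.2) &
  forall a b, g p.1 a -> g p.2 b -> U (a + b)].
pose F (p : nat * nat) : set T :=
  if `[< ok p >] then X @^-1` g p.1 `&` Y @^-1` g p.2 else set0.
have -> : (X \+ Y) @^-1` U = \bigcup_p F p.
  apply/seteqP; split => [t Ut | t [p _]]; last first.
    by rewrite /F; case: asboolP => // -[_ _ +] [Xt Yt]; exact.
  have nU : nbhs (X t + Y t) U by exact: open_nbhs_nbhs.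
  have [[/= V W] [nV nW] VW] := @add_continuous (borel G) (X t, Y t) U nU.
  have [C [BC CX] CV] := Bb _ _ nV.
  have [D [BD DY] DW] := Bb _ _ nW.
  have [n _ gn] := gB _ BC.
  have [m _ gm] := gB _ BD.
  exists (n, m) => //; rewrite /F asboolT /= ?gn ?gm//.
  split; rewrite /= ?gn ?gm; [exact: Bop|exact: Bop|].
  by move=> a b Ca Db; apply: (VW (a, b)); split => /=; [exact: CV|exact: DW].
have mo (Z : {RV P >-> borel G}) (V : set (borel G)) :
    open V -> measurable (Z @^-1` V).
  by move=> oV; apply: measurable_funPTI; exact: sub_sigma_algebra.
apply: countable_bigcupT_measurable; first exact: countableP.
move=> p; rewrite /F; case: asboolP => [[opn1 opn2 _]|_]; last exact: measurable0.
by apply: measurableI; exact: mo.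
Qed.

(* The pointwise sum [X \+ Y]; its Borel measurability uses that [G] is second
   countable. *)
Definition rv_add : {RV P >-> borel G} :=
  mfun_Sub (mem_set measurable_funD_borel).

End add_random_variables.

(* Main.v *)
Require Import Defs.
From mathcomp Require Import all_boot all_order all_algebra.
From mathcomp Require Import all_classical all_reals all_analysis.
From mathcomp Require Import measurable_realfun ring lra.

(** Write mu and nu for the laws of X and Y, fix a Borel set A and put
    g y = mu (A - y).  The hypothesis X ~ X + Y says mu = mu * nu, and this
    makes g harmonic for nu: the integral of g (x + y) over nu(dy) is g x.
    The heart of the proof is a Choquet-Deny theorem ([choquet_deny]): a bounded
    harmonic function g satisfies, for every x, g (x + y) = g x for nu-almost
    every y.  At x = 0 it gives mu (A - y) = mu A for almost every y, so that
    P (X + Y in A, Y in B), which is the integral of mu (A - y) over B, equals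
    mu A * nu B = P (X + Y in A) * P (Y in B).

    The Choquet-Deny theorem is proved here without Haar measure, characters or
    supports.  Let T f x be the integral of f (x + y) over nu(dy) and let w x be
    the integral of (g (x + y) - g x)^2, that is, w = T (g^2) - g^2.  For fixed
    y the function x |-> g (x + y) - g x is again harmonic, because translations
    commute; hence its square is subharmonic by Jensen's inequality, and
    integrating over y gives w <= T w.  If n w <= 1 - g^2 everywhere, then
    applying T gives n w <= n T w <= 1 - T (g^2) = 1 - g^2 - w, which is the same
    inequality for n + 1.  So n w <= 1 for every n, and w = 0.

    Compactness and metrisability enter only through the measurability of
    the addition for the product of the Borel sigma-algebras. *)

Import Order.TTheory GRing.Theory Num.Theory.

Local Open Scope classical_set_scope.
Local Open Scope ring_scope.

(** * Integrals of bounded functions against a probability *)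

Section bounded_functions.
Set Implicit Arguments.
Unset Strict Implicit.
Context {R : realType}.

Lemma integrable_of_normr_le {d} {S : measurableType d} (nu : probability S R)
    (f : S -> R) (M : R) :
  measurable_fun setT f -> (forall y, `|f y| <= M) ->
  nu.-integrable setT (EFin \o f).
Proof.
move=> mf fM; apply: measurable_bounded_integrable => //.
  by rewrite -ge0_fin_numE ?fin_num_measure.
by exists M; split; rewrite ?num_real// => x Mx y _; exact: le_trans (ltW Mx).
Qed.

Lemma Rintegral_cst_probability {d} {S : measurableType d}
    (nu : probability S R) (c : R) : \int[nu]_y c = c.
Proof.
rewrite Rintegral_cst// -[RHS]mulr1; congr (_ * _).
rewrite -[RHS]/(fine 1%E); congr fine; exact: probability_setT.
Qed.

Lemma normr_Rintegral_le {d} {S : measurableType d} (nu : probability S R)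
    (f : S -> R) (M : R) :
  measurable_fun setT f -> (forall y, `|f y| <= M) ->
  `|\int[nu]_y f y| <= M.
Proof.
move=> mf fM; have intf := integrable_of_normr_le nu mf fM.
apply: (le_trans (le_normr_Rintegral measurableT intf)).
rewrite -[leRHS](Rintegral_cst_probability nu); apply: le_Rintegral => //.
- by have := integrable_abse intf.
- by apply: (@integrable_of_normr_le _ _ _ _ `|M|).
Qed.

(** For [c] the mean of [f], this is the identity between the two expressions of
    the variance; boundedness makes every integral in it finite. *)
Lemma Rintegral_variance {d} {S : measurableType d} (nu : probability S R)
    (f : S -> R) (M c : R) :
  measurable_fun setT f -> (forall y, `|f y| <= M) ->
  \int[nu]_y f y = c ->
  \int[nu]_y (f y - c) ^+ 2 = \int[nu]_y f y ^+ 2 - c ^+ 2.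
Proof.
move=> mf fM fc.
have M0 : 0 <= M by exact: le_trans (fM point).
have mf2 : measurable_fun setT (fun y => f y ^+ 2) by exact: measurable_funX.
have if1 : nu.-integrable setT (EFin \o f) by exact: integrable_of_normr_le fM.
have if2 : nu.-integrable setT (EFin \o (fun y => f y ^+ 2)).
  apply: (@integrable_of_normr_le _ _ _ _ (M ^+ 2)) => // y.
  by rewrite normrX lerXn2r ?nnegrE.
have icf : nu.-integrable setT (EFin \o (fun y => 2 * c * f y)).
  apply: (@integrable_of_normr_le _ _ _ _ (`|2 * c| * M)) => //.
    by apply: measurable_funM.
  by move=> y; rewrite normrM ler_wpM2l.
have icst (k : R) : nu.-integrable setT (EFin \o (fun=> k)).
  by apply: (@integrable_of_normr_le _ _ _ _ `|k|).
transitivity (\int[nu]_y ((f y ^+ 2 - 2 * c * f y) + c ^+ 2)).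
  by apply: eq_Rintegral => y _; ring.
rewrite (RintegralD (f1 := fun y => f y ^+ 2 - 2 * c * f y)
  (f2 := fun=> c ^+ 2))//; last by have := integrableB measurableT if2 icf.
rewrite RintegralB// RintegralZl// fc Rintegral_cst_probability; ring.
Qed.

(** Jensen's inequality for the square, from the positivity of the variance. *)
Lemma sqr_Rintegral_le {d} {S : measurableType d} (nu : probability S R)
    (f : S -> R) (M : R) :
  measurable_fun setT f -> (forall y, `|f y| <= M) ->
  (\int[nu]_y f y) ^+ 2 <= \int[nu]_y f y ^+ 2.
Proof.
move=> mf fM; rewrite -subr_ge0 -(Rintegral_variance mf fM erefl).
by apply: Rintegral_ge0 => y _; exact: sqr_ge0.
Qed.

Section parameter.
Context {d1 d2} {S1 : measurableType d1} {S2 : measurableType d2}.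
Variables (F : S1 * S2 -> R) (M : R).
Hypothesis mF : measurable_fun setT F.
Hypothesis F0 : forall p, 0 <= F p.
Hypothesis FM : forall p, F p <= M.

Let normF p : `|F p| <= M.
Proof. by rewrite ger0_norm. Qed.

Lemma measurable_Rintegral_param (nu : probability S2 R) :
  measurable_fun setT (fun x => \int[nu]_y F (x, y)).
Proof.
apply: (measurableT_comp (f := fine)) => //.
apply: (measurable_fun_fubini_tonelli_F (m2 := nu) (EFin \o F)).
  exact/measurable_EFinP.
by move=> p; rewrite lee_fin.
Qed.

Lemma EFin_Rintegral_param (nu : probability S2 R) x :
  (\int[nu]_y F (x, y))%:E = (\int[nu]_y (F (x, y))%:E)%E.
Proof.
rewrite fineK//; apply: integrable_fin_num => //.
apply: (@integrable_of_normr_le _ _ _ _ M) => //.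
by apply: (measurableT_comp mF).
Qed.
End parameter.

(** Fubini's theorem for real-valued integrals: [F] is bounded, so taking the
    finite part of the inner integrals in Tonelli's theorem loses nothing. *)
Lemma Rintegral_swap {d1 d2} {S1 : measurableType d1} {S2 : measurableType d2}
    (nu1 : probability S1 R) (nu2 : probability S2 R) (F : S1 * S2 -> R) (M : R) :
  measurable_fun setT F -> (forall p, 0 <= F p) -> (forall p, F p <= M) ->
  \int[nu1]_x \int[nu2]_y F (x, y) = \int[nu2]_y \int[nu1]_x F (x, y).
Proof.
move=> mF F0 FM; rewrite /Rintegral; congr fine.
under eq_integral do rewrite (EFin_Rintegral_param mF F0 FM).
pose F' := fun p : S2 * S1 => F (p.2, p.1).
have mF' : measurable_fun setT F'.
  exact: measurableT_comp mF (@measurable_swap _ _ S2 S1).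
under [RHS]eq_integral => y _.
  rewrite (EFin_Rintegral_param (F := F') mF' (fun=> F0 _) (fun=> FM _)). over.
apply: (fubini_tonelli (EFin \o F)) => [|p]; first exact/measurable_EFinP.
by rewrite lee_fin.
Qed.
End bounded_functions.

(** * The Choquet-Deny theorem *)

Section choquet_deny.
Set Implicit Arguments.
Unset Strict Implicit.
Context {R : realType} {dT dS} {T : measurableType dT} {S : measurableType dS}.
(* The maps [op^~ y] generalise the translations of an abelian group: that they
   commute makes the increments of a harmonic function harmonic. *)
Variables (nu : probability S R) (op : T -> S -> T) (g : T -> R).
Hypothesis mop : measurable_fun setT (fun p : T * S => op p.1 p.2).
Hypothesis opAC : right_commutative op.
Hypothesis mg : measurable_fun setT g.
Hypothesis g01 : forall x, 0 <= g x <= 1.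
Hypothesis g_harmonic : forall x, \int[nu]_y g (op x y) = g x.

Let g_ge0 x : 0 <= g x. Proof. by have /andP[] := g01 x. Qed.
Let g_le1 x : g x <= 1. Proof. by have /andP[] := g01 x. Qed.
Let normg x : `|g x| <= 1. Proof. by rewrite ger0_norm. Qed.

Let normgB x x' : `|g x - g x'| <= 1.
Proof.
have := (g_ge0 x, g_le1 x, g_ge0 x', g_le1 x').
by rewrite ler_norml => -[[[? ?] ?] ?]; apply/andP; split; lra.
Qed.

Let sqr_gB_le1 x x' : (g x - g x') ^+ 2 <= 1.
Proof. by rewrite -real_normK ?num_real// expr_le1. Qed.

Let mop2 x : measurable_fun setT (op x).
Proof. exact: (measurableT_comp mop (pair1_measurable x)). Qed.

Let w x := \int[nu]_y (g (op x y) - g x) ^+ 2.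

Let wE x : w x = \int[nu]_y g (op x y) ^+ 2 - g x ^+ 2.
Proof.
apply: (Rintegral_variance (M := 1)) => //.
exact: measurableT_comp mg (mop2 x).
Qed.

Let mw : measurable_fun setT w.
Proof.
apply: (measurable_Rintegral_param
  (F := fun p => (g (op p.1 p.2) - g p.1) ^+ 2)) => [|p]; last exact: sqr_ge0.
by apply: measurable_funX; apply: measurable_funB; apply: measurableT_comp.
Qed.

Let integrable_op (f : T -> R) x : measurable_fun setT f ->
  (forall y, `|f y| <= 1) ->
  nu.-integrable setT (EFin \o (fun y => f (op x y))).
Proof.
move=> mf f1; apply: (@integrable_of_normr_le _ _ _ _ _ 1) => //.
exact: measurableT_comp mf (mop2 x).
Qed.

Let w_ge0 x : 0 <= w x.
Proof. by apply: Rintegral_ge0 => y _; exact: sqr_ge0. Qed.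

Let normw x : `|w x| <= 1.
Proof.
apply: normr_Rintegral_le => [|y]; last by rewrite ger0_norm ?sqr_ge0.
apply: measurable_funX; apply: measurable_funB => //.
exact: measurableT_comp mg (mop2 x).
Qed.

(** For fixed [y] the increment [h = fun x => g (op x y) - g x] is harmonic since
    the action commutes, so [h ^+ 2] is subharmonic; [w] averages these squares
    over [y].  In the proof [D (y, z)] is [h (op x z)]. *)
Let w_subharmonic x : w x <= \int[nu]_z w (op x z).
Proof.
pose D (p : S * S) := g (op (op x p.1) p.2) - g (op x p.2).
have mD : measurable_fun setT D.
  apply: measurable_funB; last by do 2 apply: measurableT_comp => //.
  apply: measurableT_comp => //.
  apply: (measurableT_comp mop (g := fun p => (op x p.1, p.2))).
  by apply: measurable_fun_pair => //; exact: measurableT_comp.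
have mDl y : measurable_fun setT (fun z => D (y, z)).
  exact: measurableT_comp mD (pair1_measurable y).
have mD2 : measurable_fun setT (fun p => D p ^+ 2) by exact: measurable_funX.
have D2_ge0 p : 0 <= D p ^+ 2 by exact: sqr_ge0.
have D2_le1 p : D p ^+ 2 <= 1 by exact: sqr_gB_le1.
have D2_norm p : `|D p ^+ 2| <= 1 by rewrite ger0_norm.
have -> : \int[nu]_z w (op x z) = \int[nu]_y \int[nu]_z D (y, z) ^+ 2.
  rewrite (Rintegral_swap nu nu mD2 D2_ge0 D2_le1).
  by apply: eq_Rintegral => z _; apply: eq_Rintegral => y _; rewrite /D/= opAC.
apply: le_Rintegral => // [||y _].
- apply: (@integrable_op (fun x' => (g x' - g x) ^+ 2)) => [|y].
    by apply: measurable_funX; exact: measurable_funB.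
  by rewrite ger0_norm ?sqr_ge0.
- apply: (@integrable_of_normr_le _ _ _ _ _ 1) => [|y].
    exact: measurable_Rintegral_param mD2 D2_ge0 nu.
  by apply: normr_Rintegral_le => //; exact: measurable_funX.
have -> : g (op x y) - g x = \int[nu]_z D (y, z).
  by rewrite /D/= RintegralB ?g_harmonic//; exact: (@integrable_op g).
by apply: (sqr_Rintegral_le nu (mDl y) (M := 1)) => z; exact: normgB.
Qed.

(** Averaging the bound for [n] along the action costs one more [w] on the right,
    as [g ^+ 2] averages to [g ^+ 2 + w], while the left side does not decrease. *)
Let mul_w_le n x : n%:R * w x <= 1 - g x ^+ 2.
Proof.
elim: n x => [|n IH] x; first by rewrite mul0r subr_ge0 expr_le1.
have ig2 : nu.-integrable setT (EFin \o (fun y => g (op x y) ^+ 2)).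
  apply: (@integrable_op (fun x' => g x' ^+ 2)) => [|y].
    exact: measurable_funX.
  by rewrite normrX expr_le1.
have i1 : nu.-integrable setT (EFin \o (fun=> 1 : R)).
  by apply: (@integrable_of_normr_le _ _ _ _ _ `|1|).
have : n%:R * w x <= \int[nu]_y (1 - g (op x y) ^+ 2).
  apply: (@le_trans _ _ (n%:R * \int[nu]_y w (op x y))).
    by rewrite ler_wpM2l.
  rewrite -RintegralZl//; last exact: integrable_op.
  apply: le_Rintegral => //.
    apply: (@integrable_of_normr_le _ _ _ _ _ n%:R) => [|y].
      by apply: measurable_funM => //; exact: measurableT_comp mw (mop2 x).
    by rewrite normrM normr_nat ler_piMr.
  by have := integrableB measurableT i1 ig2.
rewrite (RintegralB (f1 := fun=> 1))// Rintegral_cst_probability.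
by have := wE x; rewrite -natr1 mulrDl; lra.
Qed.

Let w_eq0 x : w x = 0.
Proof.
apply/eqP; rewrite eq_le w_ge0 andbT leNgt; apply/negP => w0.
have := mul_w_le (Num.truncn (w x)^-1).+1 x.
have : 1 < (Num.truncn (w x)^-1).+1%:R * w x.
  by rewrite -ltr_pdivrMr// div1r truncnS_gt.
by have := sqr_ge0 (g x); lra.
Qed.

(** The variance [w x] of [y |-> g (op x y)] around [g x] vanishes for every [x],
    which forces this function to be constant almost everywhere. *)
Lemma choquet_deny x : {ae nu, forall y, g (op x y) = g x}.
Proof.
have mgx : measurable_fun setT (fun y => g (op x y) - g x).
  by apply: measurable_funB => //; exact: measurableT_comp mg (mop2 x).
have m2 : measurable_fun setT (fun y => ((g (op x y) - g x) ^+ 2)%:E).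
  by apply/measurable_EFinP; exact: measurable_funX.
have : (\int[nu]_y `|((g (op x y) - g x) ^+ 2)%:E| = 0)%E.
  under eq_integral do rewrite gee0_abs ?lee_fin ?sqr_ge0//.
  rewrite -[LHS]fineK; first by congr EFin; exact: w_eq0.
  apply: integrable_fin_num => //.
  apply: (@integrable_op (fun x' => (g x' - g x) ^+ 2)) => [|y].
    by apply: measurable_funX; exact: measurable_funB.
  by rewrite ger0_norm ?sqr_ge0.
move=> /(ae_eq_integral_abs nu measurableT m2).
apply: filterS => y /(_ I) /= [] /eqP.
by rewrite sqrf_eq0 subr_eq0 => /eqP.
Qed.
End choquet_deny.

(** * Joint laws and Borel addition *)

Section independent_pairs.
Set Implicit Arguments.
Unset Strict Implicit.

(** Independence makes the joint law a product measure, which is then computed by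
    slicing.  The pair is taken as (Y, X) so that the slices are those at the
    values of Y, and the outer integral is over the law of Y. *)
Lemma independent_joint_law {R : realType} {d d1 d2} {Omega : measurableType d}
    {T1 : measurableType d1} {T2 : measurableType d2} (P : probability Omega R)
    (X : {RV P >-> T1}) (Y : {RV P >-> T2}) (D : set (T2 * T1)) :
  independent P X Y -> measurable D ->
  P [set t | D (Y t, X t)] =
    (\int[distribution P Y]_y distribution P X (xsection D y))%E.
Proof.
move=> XY mD.
have mYX : measurable_fun setT (fun t => (Y t, X t)).
  by apply: measurable_fun_pair; exact: measurable_funPT.
pose YX : {RV P >-> (T2 * T1)%type} := mfun_Sub (mem_set mYX).
transitivity ((distribution P Y \x distribution P X)%E D); last by [].
rewrite (product_measure_unique (m' := distribution P YX))// => B A mB mA.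
by rewrite muleC -[RHS]XY// setIC.
Qed.

(** The sum of two random variables is Borel, and addition is the sum of the two
    coordinates on the product space, under an arbitrary probability there. *)
Lemma measurable_add_borel {R : realType} {G : topologicalZmodType} :
  compact [set: G] -> metrisable R G ->
  measurable_fun setT (fun p : borel G * borel G => p.1 + p.2).
Proof.
move=> cG mG.
pose Q : probability (borel G * borel G)%type R :=
  @dirac _ (borel G * borel G)%type (0, 0) R.
pose X : {RV Q >-> borel G} := mfun_Sub (mem_set measurable_fst).
pose Y : {RV Q >-> borel G} := mfun_Sub (mem_set measurable_snd).
exact: (measurable_funD_borel cG mG X Y).
Qed.
End independent_pairs.

Theorem theorem12 (R : realType) (G : topologicalZmodType)
    (cG : compact [set: G]) (mG : metrisable R G)
    (d : measure_display) (Omega : measurableType d) (P : probability Omega R)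
    (X Y : {RV P >-> borel G}) :
  independent P X Y ->
  same_distribution P X (rv_add cG mG X Y) ->
  independent P (rv_add cG mG X Y) Y.
Proof.
move=> indXY eqX A B mA mB.
have madd := measurable_add_borel cG mG.
pose mu : probability (borel G) R := distribution P X.
pose nu : probability (borel G) R := distribution P Y.
have mpre (C : set (borel G)) : measurable C ->
    measurable [set p : borel G * borel G | C (p.2 + p.1)].
  have madd' : measurable_fun setT (fun p : borel G * borel G => p.2 + p.1).
    exact: measurableT_comp madd (@measurable_swap _ _ (borel G) (borel G)).
  by move=> mC; rewrite -[X in measurable X]setTI; exact: madd'.
pose D : set (borel G * borel G) := [set p | A (p.2 + p.1)].
have mD : measurable D by exact: mpre.
have DE y : xsection D y = [set z | A (z + y)].
  by apply/seteqP; split => z; rewrite /xsection/= inE.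
pose g (y : borel G) : R := fine (mu (xsection D y)).
have gE y : (g y)%:E = mu (xsection D y).
  by rewrite fineK// fin_num_measure//; exact: measurable_xsection.
have mg : measurable_fun setT g.
  by apply: (measurableT_comp (f := fine)) => //; exact: measurable_fun_xsection.
have g01 y : 0 <= g y <= 1.
  by rewrite -!lee_fin gE measure_ge0 probability_le1//; exact: measurable_xsection.
have g_harmonic x : \int[nu]_y g (x + y) = g x.
  have mDx : measurable (xsection D x) by exact: measurable_xsection.
  pose E : set (borel G * borel G) := [set p | xsection D x (p.2 + p.1)].
  have mE : measurable E by exact: mpre.
  (* The slice of [D] at [x] is [A - x], which X and X + Y hit with the same
     probability. *)
  have muDx : mu (xsection D x) = P [set t | E (Y t, X t)] by exact: eqX.
  rewrite [RHS]/g muDx.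
  rewrite (independent_joint_law indXY mE) /Rintegral; congr fine.
  apply: eq_integral => y _; rewrite gE; congr (mu _).
  rewrite DE; apply/seteqP; split => z; rewrite /xsection/= inE /E/= DE/=.
    by rewrite -addrA [y + x]addrC.
  by rewrite -addrA [y + x]addrC.
have g0 : (g 0)%:E = mu A.
  rewrite gE; congr (mu _).
  by rewrite DE; apply/seteqP; split => z; rewrite /= addr0.
have gae : {ae nu, forall y, g (0 + y) = g 0}.
  apply: (@choquet_deny _ _ _ _ _ nu (fun x y : borel G => x + y)) => // x y z.
  exact: addrAC.
rewrite -[P (rv_add cG mG X Y @^-1` A)](eqX _ mA) -/mu -/(nu B) -g0.
pose E : set (borel G * borel G) := D `&` (fst @^-1` B).
have mE : measurable E.
  apply: measurableI => //; rewrite -[X in measurable X]setTI.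
  exact: measurable_fst.
have -> : P (rv_add cG mG X Y @^-1` A `&` Y @^-1` B) =
  P [set t | E (Y t, X t)] by [].
rewrite (independent_joint_law indXY mE) -/nu -/mu.
transitivity (\int[nu]_y ((g 0)%:E * (\1_B y)%:E))%E; last first.
  rewrite ge0_integralZl//; first by rewrite integral_indic// setIT.
  - by apply/measurable_EFinP; exact: measurable_indic.
  - by rewrite gE measure_ge0.
(* The slice of [E] at [y] is [A - y] if [y] is in [B], and empty otherwise. *)
apply: ae_eq_integral => //.
- exact: measurable_fun_xsection.
- by apply/measurable_EFinP/measurable_funM => //; exact: measurable_indic.
apply: filterS gae => y; rewrite add0r => gy _.
have -> : xsection E y = [set z | A (z + y) /\ B y].
  by apply/seteqP; split => z; rewrite /xsection/= inE.
rewrite -gy gE DE indicE; have [yB|yB] := boolP (y \in B).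
  rewrite mule1; congr (mu _); apply/seteqP; split => z /=; first by case.
  by split => //; rewrite -in_setE.
rewrite mule0 (_ : [set z | _] = set0) ?measure0//.
by apply/seteqP; split => z // [_] /=; rewrite -in_setE (negPf yB).
Qed.
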